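(* For $t \geq 1$, let $G_t = K_{2t} - M$ be the graph obtained from the complete graph $K_{2t}$ by deleting the edges of a perfect matching $M$. Then for every integer $\ell$ with $0 \leq \ell < t$, the Bell colour graph $\mathcal{B}_{t+\ell}(G_t)$ is not Hamiltonian; that is, it is not Hamiltonian for all $t + \ell < 2t = |V(G_t)|$.
   Context: Graphs are finite and simple. For a graph $G$ and a positive integer $k$, the $k$-Bell colour graph of $G$, denoted $\mathcal{B}_k(G)$, is the graph whose vertices are the partitions of $V(G)$ into $k$ or fewer (non-empty) independent sets, with different partitions $p_1$ and $p_2$ being adjacent if there is a vertex $x \in V(G)$ such that the restrictions of $p_1$ and $p_2$ to $V(G)-\{x\}$ are equal (after restriction, empty cells are discarded). A graph is Hamiltonian if it has a cycle containing all of its vertices; in particular a Hamiltonian graph has at least three vertices, so $K_1$ and $K_2$ are not Hamiltonian. *)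

(* Defs.v *)
From mathcomp Require Import all_boot.

Set Implicit Arguments.
Unset Strict Implicit.
Unset Printing Implicit Defensive.

Record sgraph := SGraph {
  vertex :> finType;
  adj : rel vertex;
  adj_sym : symmetric adj;
  adj_irrefl : irreflexive adj
}.

Definition edges (G : sgraph) : {set {set G}} :=
  [set e | [exists x : G, exists y : G, adj x y && (e == [set x; y])]].

Definition independent (G : sgraph) (B : {set G}) : bool :=
  [forall x in B, forall y in B, ~~ adj x y].

Definition perfect_matching (G : sgraph) (M : {set {set G}}) : bool :=
  (M \subset edges G) && [forall x : G, #|[set e in M | x \in e]| == 1].

(* [size c > 2] is needed because [ucycle] also accepts the empty sequence and
   closed walks x, y, x along a single edge. *)
Definition hamiltonian (G : sgraph) : Prop :=
  exists c : seq G,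
    [/\ ucycle (@adj G) c, 2 < size c & forall x : G, x \in c].

Section Complete.
Variable n : nat.

Definition complete_adj : rel 'I_n := fun x y => x != y.

Lemma complete_adj_sym : symmetric complete_adj.
Proof. by move=> x y; rewrite /complete_adj eq_sym. Qed.

Lemma complete_adj_irrefl : irreflexive complete_adj.
Proof. by move=> x; rewrite /complete_adj eqxx. Qed.

Definition complete : sgraph := SGraph complete_adj_sym complete_adj_irrefl.
End Complete.

Section DeleteEdges.
Variables (G : sgraph) (M : {set {set G}}).

Definition del_edges_adj : rel G :=
  fun x y => adj x y && ([set x; y] \notin M).

Lemma del_edges_adj_sym : symmetric del_edges_adj.
Proof. by move=> x y; rewrite /del_edges_adj adj_sym setUC. Qed.

Lemma del_edges_adj_irrefl : irreflexive del_edges_adj.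
Proof. by move=> x; rewrite /del_edges_adj adj_irrefl. Qed.

Definition del_edges : sgraph :=
  SGraph del_edges_adj_sym del_edges_adj_irrefl.
End DeleteEdges.

Section BellColourGraph.
Variables (k : nat) (G : sgraph).

(* [partition] already requires every cell to be non-empty. *)
Definition bell_colouring (P : {set {set G}}) : bool :=
  [&& partition P [set: G], [forall B in P, independent B] & #|P| <= k].

Definition bell_vertex := {P : {set {set G}} | bell_colouring P}.

(* The restriction of P to V(G) - {x}, with the cell that may have become empty
   discarded. *)
Definition restrict_away (x : G) (P : {set {set G}}) : {set {set G}} :=
  [set B :\ x | B in P] :\ set0.

Definition bell_adj : rel bell_vertex := fun p1 p2 =>
  (p1 != p2) &&
  [exists x : G, restrict_away x (val p1) == restrict_away x (val p2)].

Lemma bell_adj_sym : symmetric bell_adj.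
Proof.
move=> p1 p2; rewrite /bell_adj eq_sym; congr (_ && _).
by apply: eq_existsb => x; rewrite eq_sym.
Qed.

Lemma bell_adj_irrefl : irreflexive bell_adj.
Proof. by move=> p; rewrite /bell_adj eqxx. Qed.

Definition bell_graph : sgraph := SGraph bell_adj_sym bell_adj_irrefl.
End BellColourGraph.

(* Main.v *)
Require Import Defs.
From mathcomp Require Import all_boot zify.

Set Implicit Arguments.
Unset Strict Implicit.
Unset Printing Implicit Defensive.

(** A partition of [G_t] into independent sets has only singletons and edges of
    the deleted matching [M] as cells
    ([independent_matching_cell]), so it is determined by the set [A] of
    matching edges that it uses as cells, and it has [2t - #|A|] cells.  Hence
    the vertices of the Bell colour graph are the subsets [A] of [M] with
    [#|A| >= t - l] ([merged_inj], [imset_merged]).  Moving one vertex [x] of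
    [G_t] can only create or destroy the cell given by the matching edge at
    [x], so adjacent partitions have sets [A] whose sizes differ in parity
    ([bell_adj_odd]): the Bell colour graph is the bipartite graph formed by
    some layers of a hypercube.

    The two sides of a bipartite Hamiltonian graph have the same size
    ([hamiltonian_balanced]).  Here they do not ([upper_layers_unbalanced]).
    Put [m = t - l > 0], and fix a matching edge [e].  Toggling [e] sends the
    sets of size at least [m] whose parity is not that of [m] injectively into
    those with the parity of [m], and it misses each set of size exactly [m]
    that contains [e]. *)

(** * Bipartite Hamiltonian graphs *)

(** The successor map along a Hamiltonian cycle is injective and exchanges the
    two colours. *)
Lemma hamiltonian_balanced (G : sgraph) (c : G -> bool) :
  (forall x y : G, adj x y -> c y = ~~ c x) ->
  hamiltonian G -> #|[set x | c x]| = #|[set x | ~~ c x]|.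
Proof.
move=> c_adj [s [/andP[s_cycle s_uniq] _ s_all]].
have next_inj : injective (next s) := can_inj (prev_next s_uniq).
have c_next x : c (next s x) = ~~ c x by apply/c_adj/next_cycle.
apply/eqP; rewrite eqn_leq -{1}(card_imset _ next_inj).
rewrite -[X in _ && (X <= _)](card_imset _ next_inj).
by apply/andP; split; apply/subset_leq_card/subsetP => _ /imsetP[x + ->];
  rewrite !inE c_next ?negbK.
Qed.

(** * Upper layers of a hypercube *)

Section Toggle.
Variables (T : finType) (e : T).
Implicit Types A M : {set T}.

Definition toggle A := if e \in A then A :\ e else e |: A.

Lemma toggleK : involutive toggle.
Proof.
move=> A; rewrite /toggle; have [eA|eA] := boolP (e \in A).
  by rewrite !inE eqxx /= setD1K.
by rewrite !inE eqxx /= setU1K.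
Qed.

Lemma toggle_sub A M : e \in M -> A \subset M -> toggle A \subset M.
Proof.
move=> eM sAM; rewrite /toggle; case: ifP => _.
  exact: subset_trans (subD1set _ _) sAM.
by rewrite subUset sub1set eM.
Qed.

Lemma card_toggle A : #|toggle A| = if e \in A then #|A|.-1 else #|A|.+1.
Proof.
rewrite /toggle; case: ifP => eA; last by rewrite cardsU1 eA.
by rewrite [in RHS](cardsD1 e) eA.
Qed.

Lemma odd_card_toggle A : odd #|toggle A| = ~~ odd #|A|.
Proof.
rewrite card_toggle; case: ifP => // eA.
by rewrite (cardsD1 e A) eA /= negbK.
Qed.

End Toggle.

Lemma upper_layers_unbalanced (T : finType) (M : {set T}) m :
  0 < m <= #|M| ->
  #|[set A : {set T} | [&& A \subset M, m <= #|A| & odd #|A| != odd m]]| <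
  #|[set A : {set T} | [&& A \subset M, m <= #|A| & odd #|A| == odd m]]|.
Proof.
case/andP=> m_gt0 le_mM.
have [B sBM cardB] : exists2 B : {set T}, B \subset M & #|B| = m.
  have : 0 < #|[set B : {set T} | B \subset M & #|B| == m]|.
    by rewrite cards_draws bin_gt0.
  by case/card_gt0P=> B; rewrite inE => /andP[sBM /eqP]; exists B.
have /card_gt0P[e eB] : 0 < #|B| by rewrite cardB.
have eM := subsetP sBM _ eB.
rewrite -(card_imset _ (inv_inj (toggleK e))).
apply/proper_card/properP; split.
  apply/subsetP=> _ /imsetP[A + ->]; rewrite !inE => /and3P[sAM le_mA oddA].
  rewrite toggle_sub // odd_card_toggle card_toggle.
  (* The parities differ, so [#|A| > m] and one element can be removed. *)
  have lt_mA : m < #|A|.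
    by rewrite ltn_neqAle le_mA andbT; apply: contraNneq oddA => ->.
  by case: ifP oddA => _; case: (odd _); case: (odd _) => //= _; lia.
exists B; first by rewrite inE sBM cardB leqnn eqxx.
apply/imsetP=> -[A]; rewrite inE => /and3P[_ le_mA _] defB.
have := card_toggle e B; rewrite eB cardB defB toggleK; lia.
Qed.

(** * Partitions into matching edges and singletons *)

Section Pairing.
Variables (T : finType) (M : {set {set T}}).
Hypothesis partM : partition M [set: T].
Hypothesis card_edge : forall e, e \in M -> #|e| = 2.
Implicit Types (A P : {set {set T}}) (B e : {set T}).

Definition matching_cell B := B \in M \/ exists x, B = [set x].

Lemma singleton_notin x : [set x] \notin M.
Proof. by apply/negP=> /card_edge; rewrite cards1. Qed.

(** Two matching edges that share a vertex coincide, so all the vertices of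
    [B] lie in the matching edge of one of them. *)
Lemma pairwise_edge_cell B :
  B != set0 -> {in B &, forall x y, x != y -> [set x; y] \in M} ->
  matching_cell B.
Proof.
case/set0Pn=> x xB edgeB; have tiM := partition_trivIset partM.
have [B1|] := boolP (B \subset [set x]).
  by right; exists x; apply/eqP; rewrite eqEsubset B1 sub1set.
case/subsetPn=> y yB; rewrite inE => neq_yx; left.
have exy : [set x; y] \in M by apply: edgeB; rewrite // eq_sym.
suff -> : B = [set x; y] by [].
apply/eqP; rewrite eqEsubset subUset !sub1set xB yB !andbT.
apply/subsetP=> z zB.
have [->|neq_zx] := eqVneq z x; first by rewrite !inE eqxx.
have exz : [set x; z] \in M by apply: edgeB; rewrite // eq_sym.
have xin u : x \in [set x; u] by rewrite !inE eqxx.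
rewrite -(def_pblock tiM exy (xin y)) (def_pblock tiM exz (xin z)).
by rewrite !inE eqxx orbT.
Qed.

(** A cell [B] has one element, plus another one when it is an edge. *)
Lemma matching_cell_partition_card P :
  partition P [set: T] -> {in P, forall B, matching_cell B} ->
  #|P| + #|P :&: M| = #|T|.
Proof.
move=> partP cellP; rewrite -cardsT (card_partition partP).
rewrite -[#|P|]sum1_card -[#|P :&: M|]sum1_card.
rewrite [X in _ + X = _](eq_bigl (fun B => (B \in P) && (B \in M))); last first.
  by move=> B; rewrite inE.
rewrite big_mkcondr -big_split /=; apply: eq_bigr => B /cellP[BM|[x ->]].
  by rewrite BM card_edge.
by rewrite (negPf (singleton_notin x)) cards1.
Qed.

(** The singleton cells of such a partition are the vertices that its matching
    edges do not cover. *)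
Lemma matching_cell_partition_inj P1 P2 :
  partition P1 [set: T] -> {in P1, forall B, matching_cell B} ->
  partition P2 [set: T] -> {in P2, forall B, matching_cell B} ->
  P1 :&: M = P2 :&: M -> P1 = P2.
Proof.
have sub P Q : partition P [set: T] -> {in P, forall B, matching_cell B} ->
    partition Q [set: T] -> {in Q, forall B, matching_cell B} ->
    P :&: M = Q :&: M -> P \subset Q.
  move=> partP cellP partQ cellQ eqPQ; apply/subsetP=> B BP.
  have [BM|[x defB]] := cellP B BP.
    by have: B \in P :&: M by [rewrite inE BP]; rewrite eqPQ inE => /andP[].
  have xQ : x \in cover Q by rewrite (cover_partition partQ).
  have QB := pblock_mem xQ; have xB : x \in pblock Q x by rewrite mem_pblock.
  have [CM|[y defC]] := cellQ _ QB.
    have: pblock Q x \in P :&: M by rewrite eqPQ inE QB.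
    rewrite inE => /andP[CP _].
    have tiP := partition_trivIset partP.
    have xBB : x \in B by rewrite defB inE.
    have eqB := def_pblock tiP BP xBB; have eqC := def_pblock tiP CP xB.
    by rewrite -eqB eqC.
  by move: xB QB; rewrite defC inE defB => /eqP->.
move=> part1 cell1 part2 cell2 eq12; apply/eqP.
by rewrite eqEsubset !sub.
Qed.

Definition add_singletons A := A :|: [set [set x] | x in ~: cover A].

Lemma add_singletons_cell A :
  A \subset M -> {in add_singletons A, forall B, matching_cell B}.
Proof.
move=> sAM B; rewrite inE => /orP[/(subsetP sAM)|/imsetP[x _ ->]]; first by left.
by right; exists x.
Qed.

Lemma add_singletons_merged A : A \subset M -> add_singletons A :&: M = A.
Proof.
move=> sAM; apply/setP=> B; rewrite !inE.
have [BA|BA] /= := boolP (B \in A); first exact: (subsetP sAM).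
by apply/andP=> -[/imsetP[x _ ->]]; apply/negP/singleton_notin.
Qed.

Lemma add_singletons_partition A :
  A \subset M -> partition (add_singletons A) [set: T].
Proof.
move=> sAM; have tiA := trivIsetS sAM (partition_trivIset partM).
apply/and3P; split.
- rewrite eqEsubset subsetT; apply/subsetP=> x _.
  have [/bigcupP[B BA xB]|xA] := boolP (x \in cover A).
    by apply/bigcupP; exists B; rewrite // inE BA.
  apply/bigcupP; exists [set x]; last by rewrite inE.
  by rewrite inE; apply/orP; right; apply: imset_f; rewrite inE.
- have disj x B : x \notin cover A -> B \in A -> [disjoint [set x] & B].
    move=> xA BA; rewrite disjoints1; apply: contra xA => xB.
    by apply/bigcupP; exists B.
  apply/trivIsetP=> B C; rewrite !inE.
  move=> /orP[BA|/imsetP[x xA ->]] /orP[CA|/imsetP[y yA ->]].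
  + exact: (trivIsetP tiA).
  + by move: yA; rewrite inE => yA _; rewrite disjoint_sym disj.
  + by move: xA; rewrite inE => xA _; rewrite disj.
  + by move=> neq; rewrite disjoints1 inE; apply: contraNneq neq => ->.
- rewrite inE; apply/norP; split.
    by apply/negP=> /(subsetP sAM)/card_edge; rewrite cards0.
  by apply/imsetP=> -[x _ /eqP]; rewrite eq_sym -cards_eq0 cards1.
Qed.

End Pairing.

(** Moving [x] affects only the matching edge at [x]: a cell that is not an
    edge [e] avoiding [x], but shrinks to it, would have three elements. *)
Lemma mem_restrict_away (G : sgraph) (M P : {set {set G}}) (x : G)
    (e : {set G}) :
  (forall f, f \in M -> #|f| = 2) -> {in P, forall B, matching_cell M B} ->
  e \in M -> x \notin e -> (e \in restrict_away x P) = (e \in P).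
Proof.
move=> card_edge cellP eM xe; rewrite !inE -cards_eq0 (card_edge _ eM) /=.
apply/imsetP/idP=> [[B BP defe]|eP]; last first.
  exists e => //; apply/setP=> y; rewrite !inE; case: eqVneq => // ->.
  exact: negPf.
have := cardsD1 x B; rewrite -defe (card_edge _ eM).
have [xB|xB _] := boolP (x \in B).
  by case: (cellP B BP) => [/card_edge ->|[y ->]]; rewrite ?cards1.
suff -> : e = B by [].
rewrite defe; apply/setP=> y; rewrite !inE; case: eqVneq => // ->.
by rewrite (negPf xB).
Qed.

(** * Bell colour graphs of complete graphs minus a perfect matching *)

Section Matching.
Variables (G : sgraph) (M : {set {set G}}).
Hypothesis matchM : perfect_matching M.

Lemma matching_card e : e \in M -> #|e| = 2.
Proof.
case/andP: matchM => /subsetP sME _ /sME; rewrite inE.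
case/existsP=> x /existsP[y /andP[xy /eqP->]]; rewrite cards2.
by case: eqVneq xy => // ->; rewrite adj_irrefl.
Qed.

Lemma matching_partition : partition M [set: G].
Proof.
case/andP: matchM => _ /forallP one_edge; apply/and3P; split.
- rewrite eqEsubset subsetT; apply/subsetP=> x _.
  have /cards1P[e defe] := one_edge x.
  have : e \in [set f in M | x \in f] by rewrite defe inE.
  by rewrite inE => /andP[eM xe]; apply/bigcupP; exists e.
- apply/trivIsetP=> e f eM fM; apply: contraR => /pred0Pn[x /andP[/= xe xf]].
  have /cards1P[g defg] := one_edge x.
  have : e \in [set h in M | x \in h] by rewrite inE eM.
  have : f \in [set h in M | x \in h] by rewrite inE fM.
  by rewrite defg !inE => /eqP-> /eqP->.
- by apply/negP=> /matching_card; rewrite cards0.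
Qed.

End Matching.

Section CompleteMinusMatching.
Variables (n k : nat) (M : {set {set complete n}}).
Hypothesis matchM : perfect_matching (G := complete n) M.

Let H := del_edges (G := complete n) M.
Let partM : partition M [set: 'I_n] := matching_partition matchM.
Let card_edge : forall e, e \in M -> #|e| = 2 := matching_card matchM.

Lemma independent_matching_cell (B : {set 'I_n}) :
  B != set0 -> independent (G := H) B <-> matching_cell M B.
Proof.
move=> B0; split=> [indB|cellB].
  apply: (pairwise_edge_cell partM) => // x y xB yB neq_xy.
  have /forall_inP/(_ x xB)/forall_inP/(_ y yB) := indB.
  by rewrite /= /del_edges_adj /= /complete_adj neq_xy negbK.
apply/forall_inP=> x xB; apply/forall_inP=> y yB.
rewrite /= /del_edges_adj /= /complete_adj negb_and !negbK.
have [//|neq_xy] /= := eqVneq x y.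
case: cellB => [BM|[z defB]]; last first.
  by move: xB yB neq_xy; rewrite defB !inE => /eqP-> /eqP->; rewrite eqxx.
suff -> : [set x; y] = B by [].
by apply/eqP; rewrite eqEcard subUset !sub1set xB yB cards2 neq_xy card_edge.
Qed.

Implicit Type p : bell_vertex k H.

Lemma bell_partition p : partition (val p) [set: 'I_n].
Proof. by case/and3P: (valP p). Qed.

Lemma bell_cell p : {in val p, forall B, matching_cell M B}.
Proof.
move=> B BP; case/and3P: (valP p) => /and3P[_ _ P0] /forall_inP/(_ B BP) indB _.
by apply/independent_matching_cell => //; apply: contraNneq P0 => <-.
Qed.

Definition merged p : {set {set 'I_n}} := val p :&: M.

Lemma merged_inj : injective merged.
Proof.
move=> p1 p2 eq12; apply: val_inj.
by apply: (matching_cell_partition_inj (M := M)) eq12;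
  try exact: bell_partition; try exact: bell_cell.
Qed.

Lemma imset_merged :
  [set merged p | p : bell_vertex k H] =
  [set A : {set {set 'I_n}} | A \subset M & n - k <= #|A|].
Proof.
apply/setP=> A; rewrite inE; apply/imsetP/andP=> [[p _ ->]|[sAM leA]].
  split; first exact: subsetIr.
  have := matching_cell_partition_card card_edge (bell_partition p) (@bell_cell p).
  rewrite card_ord leq_subLR => card_cells; rewrite -[X in X <= _]card_cells.
  by rewrite leq_add2r; case/and3P: (valP p).
have partA := add_singletons_partition partM card_edge sAM.
have cellA := add_singletons_cell sAM.
have bellA : bell_colouring k (G := H) (add_singletons A).
  apply/and3P; split=> //.
    apply/forall_inP=> B BA; apply/independent_matching_cell; last exact: cellA.
    by case/and3P: partA => _ _; apply: contraNneq => <-.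
  have := matching_cell_partition_card card_edge partA cellA.
  rewrite (add_singletons_merged card_edge sAM) card_ord => card_cells.
  by move: leA; rewrite leq_subLR -[X in X <= _]card_cells leq_add2r.
exists (Sub _ bellA) => //.
by rewrite /merged SubK (add_singletons_merged card_edge sAM).
Qed.

(** The two partitions agree on all matching edges except the one at the moved
    vertex, where they must differ because partitions are determined by their
    matching edges. *)
Lemma bell_adj_odd p1 p2 :
  bell_adj p1 p2 -> odd #|merged p2| = ~~ odd #|merged p1|.
Proof.
case/andP=> neq12 /existsP[x /eqP eq_away].
have tiM := partition_trivIset partM; set e := pblock M x.
have eq_off : merged p1 :\ e = merged p2 :\ e.
  apply/setP=> f; rewrite !inE; have [//|neq_fe] /= := eqVneq f e.
  have [fM|] := boolP (f \in M); last by rewrite !andbF.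
  have xf : x \notin f.
    by apply: contraNN neq_fe => /(def_pblock tiM fM) defe; rewrite /e defe.
  have mem_away p := mem_restrict_away (G := H) card_edge (@bell_cell p) fM xf.
  by rewrite !andbT -!mem_away eq_away.
have neq_e : (e \in merged p1) != (e \in merged p2).
  apply: contraNneq neq12 => eq_e; apply/eqP/merged_inj/setP=> f.
  by have [->//|neq_fe] := eqVneq f e;
    move/setP: eq_off => /(_ f); rewrite !in_setD1 neq_fe.
rewrite (cardsD1 e (merged p1)) (cardsD1 e (merged p2)) eq_off !oddD.
by case: (e \in _) (e \in _) neq_e => [] [] //= _; rewrite negbK.
Qed.

End CompleteMinusMatching.

Theorem mainTheorem4 (t : nat) (ht : 1 <= t)
    (M : {set {set complete (2 * t)}})
    (hM : perfect_matching (G := complete (2 * t)) M)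
    (l : nat) (hl : l < t) :
  ~ hamiltonian (bell_graph (t + l) (del_edges (G := complete (2 * t)) M)).
Proof.
set m := 2 * t - (t + l).
have cardM : #|M| = t.
  have := card_uniform_partition (matching_card hM) (matching_partition hM).
  by rewrite cardsT card_ord; lia.
have /upper_layers_unbalanced : 0 < m <= #|M| by rewrite cardM /m; lia.
pose c (p : bell_graph (t + l) (del_edges M)) := odd #|merged p| == odd m.
(* Taking [f] to be [id] and [negb] gives the two colour classes of [c]. *)
have card_class (f : bool -> bool) :
    #|[set p | f (c p)]| =
    #|[set A : {set {set 'I_(2 * t)}} |
        [&& A \subset M, m <= #|A| & f (odd #|A| == odd m)]]|.
  rewrite -(card_imset _ (@merged_inj _ _ _ hM)); apply: eq_card => A.
  apply/imsetP/idP=> [[p + ->]|].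
    have: merged p \in [set merged q | q : bell_vertex (t + l) (del_edges M)].
      exact: imset_f.
    by rewrite (imset_merged _ hM) !inE => /andP[-> ->].
  rewrite inE andbA => /andP[sizeA cA].
  have: A \in [set merged q | q : bell_vertex (t + l) (del_edges M)].
    by rewrite (imset_merged _ hM) inE.
  by case/imsetP=> p _ defA; exists p; rewrite // inE /c -defA.
rewrite -(card_class negb) -(card_class id) => lt_classes.
move/(hamiltonian_balanced (c := c)) => eq_classes.
move: lt_classes; rewrite eq_classes ?ltnn // => p q /(bell_adj_odd hM).
by rewrite /c => ->; case: (odd _) (odd _) => [] [].
Qed.
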